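(* Let $\mathbf{x}\in\{0,1\}^{\mathbb{N}}$ be a uniformly recurrent binary infinite word with uniform frequency $\mathrm{freq}_{\mathbf{x}}(1)=\alpha$, where $\alpha$ is irrational. Assume further that there is $n_0\in\mathbb{N}$ such that for each $n\ge n_0$ the word $\mathbf{x}$ contains a factor of length $n$ having weight $\lceil n\alpha\rceil+1$ and another factor of length $n$ having weight $\lfloor n\alpha\rfloor-1$. Then the abelian closure $\mathcal{A}(\mathbf{x})$ contains uncountably many minimal subshifts.
   Context: A factor of a word is a finite block of its consecutive letters; $\mathcal{L}(\mathbf{x})$ is the set of factors of $\mathbf{x}$, and $\mathcal{L}_n(\mathbf{x})$ the set of those of length $n$. The weight of a finite binary word $v$ is $|v|_1$, its number of occurrences of the letter $1$. The word $\mathbf{x}$ has uniform frequency $\alpha=\mathrm{freq}_{\mathbf{x}}(1)$ of the letter $1$ if $\lim_{n\to\infty}\frac1n\max_{v\in\mathcal{L}_n(\mathbf{x})}|v|_1=\lim_{n\to\infty}\frac1n\min_{v\in\mathcal{L}_n(\mathbf{x})}|v|_1=\alpha$. The word $\mathbf{x}$ is uniformly recurrent if for every factor $u$ of $\mathbf{x}$ there is $N$ such that every factor of $\mathbf{x}$ of length $N$ contains $u$. Two finite words $u,v$ are abelian equivalent, $u\sim v$, if every letter occurs equally many times in both. The abelian closure of $\mathbf{x}$ is $\mathcal{A}(\mathbf{x})=\{\mathbf{y}\in\{0,1\}^{\mathbb{N}} : \text{for every } u\in\mathcal{L}(\mathbf{y}) \text{ there is } v\in\mathcal{L}(\mathbf{x})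 \text{ with } u\sim v\}$. A subshift is a non-empty closed set $X\subseteq\{0,1\}^{\mathbb{N}}$ (product topology) with $\sigma(X)\subseteq X$, where $\sigma(a_0a_1a_2\cdots)=a_1a_2\cdots$; it is minimal if it does not properly contain any subshift. ''Contains uncountably many minimal subshifts'' means that uncountably many distinct minimal subshifts are subsets of $\mathcal{A}(\mathbf{x})$. *)

(* Defs.v *)
From HB Require Import structures.
From mathcomp Require Import all_boot all_order all_algebra.
From mathcomp Require Import all_classical all_reals all_analysis.

Set Implicit Arguments.
Unset Strict Implicit.
Unset Printing Implicit Defensive.

Import Order.TTheory GRing.Theory Num.Theory.
Import numFieldNormedType.Exports.

Local Open Scope classical_set_scope.
Local Open Scope ring_scope.

(* Infinite binary words are the points of [cantor_space], i.e. functions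
   nat -> bool with the product topology; the letter 1 is [true] and the
   letter 0 is [false]. *)

Definition language (x : cantor_space) : set (seq bool) :=
  [set u | exists i n : nat, u = mkseq (fun k : nat => x (i + k)%N) n].

Definition language_n (x : cantor_space) (n : nat) : set (seq bool) :=
  [set u | language x u /\ size u = n].

Definition weight (v : seq bool) : nat := count_mem true v.

Definition max_weight (x : cantor_space) (n : nat) : nat :=
  \max_(v : n.-tuple bool | `[< language_n x n v >]) weight v.

(* The default value n is harmless: words of length n have weight at most n,
   and x has at least one factor of each length. *)
Definition min_weight (x : cantor_space) (n : nat) : nat :=
  \big[minn/n]_(v : n.-tuple bool | `[< language_n x n v >]) weight v.

Definition uniform_frequency (R : realType) (x : cantor_space) (alpha : R) :
    Prop :=
  ((max_weight x n)%:R / n%:R : R) @[n --> \oo] --> alpha /\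
  ((min_weight x n)%:R / n%:R : R) @[n --> \oo] --> alpha.

Definition uniformly_recurrent (x : cantor_space) : Prop :=
  forall u, language x u ->
    exists N : nat, forall v, language_n x N v -> infix u v.

Definition abelian_equiv (u v : seq bool) : Prop :=
  forall a : bool, count_mem a u = count_mem a v.

Definition abelian_closure (x : cantor_space) : set cantor_space :=
  [set y | forall u, language y u ->
    exists v, language x v /\ abelian_equiv u v].

Definition shift (x : cantor_space) : cantor_space := fun n : nat => x n.+1.

Definition subshift (X : set cantor_space) : Prop :=
  [/\ X !=set0, closed X & shift @` X `<=` X].

Definition minimal_subshift (X : set cantor_space) : Prop :=
  subshift X /\ forall Y : set cantor_space, subshift Y -> ~ Y `<` X.

(* Main.v *)
Require Import Defs.
From HB Require Import structures.
From mathcomp Require Import all_boot all_order all_algebra.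
From mathcomp Require Import all_classical all_reals all_analysis.
From mathcomp Require Import ring lra zify.

Set Implicit Arguments.
Unset Strict Implicit.
Unset Printing Implicit Defensive.

Import Order.TTheory GRing.Theory Num.Theory.
Import numFieldNormedType.Exports.

Local Open Scope classical_set_scope.
Local Open Scope ring_scope.

(* The discrepancy of y is the sequence |y_0 ... y_(n-1)|_1 - n alpha.  For small
   t > 0, lifting the orbits of the rotation by alpha from the circle to the
   fundamental domain [-1, -1 + t/2] u [-1 + t, 0] u [t/2, t] produces words
   whose discrepancy is confined to a translate of that set.  These words form
   a subshift; a factor of length n has weight at distance at most 1 + t from
   n alpha, hence is abelian equivalent to a factor of x when n is large by the
   hypothesis on the weights, and when n is small because no integer lies at
   distance between 1 and 1 + t from n alpha.  The discrepancy of each of these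
   words oscillates by exactly 1 + t since the multiples of alpha are dense
   modulo 1, so different t give disjoint subshifts, and each of these contains
   a minimal one. *)

(** * Multiples of an irrational number modulo 1 *)

Lemma irrational_mulrn_neq (R : realType) (alpha : R) (n : nat) (m : int) :
  irrational alpha -> (0 < n)%N -> n%:R * alpha != m%:~R.
Proof.
move=> irr n0; apply/eqP => e; apply: irr.
exists (m%:~R / n%:R) => //.
rewrite fmorph_div rmorph_int rmorph_nat -e mulrAC divff ?mul1r//.
by rewrite pnatr_eq0 -lt0n.
Qed.

(** Pigeonhole: the first [N.+1] multiples have their fractional parts in [N] intervals of length
    [1/N < eps], so two of them share an interval. *)
Lemma dirichlet_approx (R : realType) (alpha eps : R) : 0 < eps ->
  exists (q : nat) (p : int), (0 < q)%N /\ `|q%:R * alpha - p%:~R| < eps.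
Proof.
move=> e0.
pose N := (Num.truncn eps^-1).+1.
have N0 : 0 < N%:R :> R by rewrite ltr0n.
have Ne : 1 < N%:R * eps.
  by rewrite -ltr_pdivrMr// mul1r; apply: truncnS_gt.
pose fr (k : nat) : R := k%:R * alpha - (Num.floor (k%:R * alpha))%:~R.
have fr01 k : 0 <= fr k < 1.
  by have := floor_itv (k%:R * alpha); rewrite intrD /fr => ?; apply/andP; split; lra.
pose g k := `|Num.floor (N%:R * fr k)|%N.
have gE k : (g k)%:R <= N%:R * fr k < (g k)%:R + 1.
  have := floor_itv (N%:R * fr k).
  have h : 0 <= Num.floor (N%:R * fr k).
    by rewrite floor_ge0 mulr_ge0// ?ler0n//; case/andP: (fr01 k).
  have -> : (g k)%:R = (Num.floor (N%:R * fr k))%:~R :> R.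
    by rewrite -[in RHS](gez0_abs h).
  by rewrite intrD.
have [inj|] := pselect {in `I_N.+1 &, injective g}.
  have /(pigeonhole inj) : g @` `I_N.+1 `<=` `I_N; last by rewrite ltnn.
  move=> _ [k _ <-] /=; have /andP[h1 _] := gE k; have /andP[_ h2] := fr01 k.
  by rewrite -(ltr_nat R) (le_lt_trans h1)// gtr_pMr.
move=> ninj.
have [i [j [ij gij]]] : exists i j, (i < j)%N /\ g i = g j.
  apply: contrapT => H; apply: ninj => i j _ _ gij; apply: contrapT => /eqP.
  by rewrite neq_ltn => /orP[] ltij; apply: H; [exists i, j|exists j, i].
exists (j - i)%N, (Num.floor (j%:R * alpha) - Num.floor (i%:R * alpha)).
rewrite subn_gt0; split=> //.
rewrite natrB 1?ltnW// intrB.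
have := gE i; have := gE j; rewrite gij => h1 h2.
have : `|N%:R * (fr j - fr i)| < N%:R * eps.
  by rewrite (lt_trans _ Ne)// ltr_norml; lra.
rewrite normrM gtr0_norm// ltr_pM2l//; congr (`| _ | < _); rewrite /fr; ring.
Qed.

(** The bound [N] is uniform in [a], so that a prefix of fixed length, with a single offset [rho],
    suffices when density is applied to [banded] words. *)
Lemma multiples_dense_mod1 (R : realType) (alpha eps : R) :
  irrational alpha -> 0 < eps ->
  exists N : nat, forall a : R, exists (k : nat) (m : int),
    (k <= N)%N /\ a < k%:R * alpha - m%:~R < a + eps.
Proof.
move=> irr e0; have [q [p [q0 qp]]] := dirichlet_approx alpha e0.
pose d := q%:R * alpha - p%:~R.
have d0 : d != 0 by rewrite subr_eq0 irrational_mulrn_neq.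
pose M := (Num.truncn `|d|^-1).+1.
have nd0 : 0 < `|d| by rewrite normr_gt0.
have Md : 1 < M%:R * `|d|.
  by rewrite -ltr_pdivrMr// mul1r; apply: truncnS_gt.
(* Walk by steps of length |d| < eps from an integer at distance less than 1
   from the interval, on the side from which d points to it. *)
have walk (b : R) : 0 <= b < 1 ->
    exists j, (j <= M)%N /\ b < j%:R * `|d| < b + eps.
  (* This is the first multiple of [|d|] beyond [b]; it overshoots by at most [|d| < eps]. *)
  move=> /andP[b0 b1]; exists (Num.truncn (b / `|d|)).+1; split.
    rewrite ltnS; apply: le_truncn.
    by rewrite ler_piMl ?invr_ge0// ltW.
  have bd : 0 <= b / `|d| by rewrite divr_ge0.
  have := truncn_itv bd; rewrite ler_pdivlMr// ltr_pdivrMr// => /andP[h ->] /=.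
  rewrite -natr1 mulrDl mul1r; apply: ler_ltD => //.
exists (M * q)%N => a.
have [d_gt0|d_le0] := ltrP 0 d.
- have [|j [jM jb]] := walk (a - (Num.floor a)%:~R).
    have := floor_itv a; rewrite intrD; lra.
  exists (j * q)%N, (j%:Z * p - Num.floor a); split.
    by rewrite leq_mul2r jM orbT.
  move: jb; rewrite gtr0_norm// /d intrB intrM natrM -[j%:~R]/(j%:R); lra.
- have [|j [jM jb]] := walk ((Num.ceil (a + eps))%:~R - (a + eps)).
    have := ceil_itv (a + eps); rewrite intrB; lra.
  exists (j * q)%N, (j%:Z * p - Num.ceil (a + eps)); split.
    by rewrite leq_mul2r jM orbT.
  move: jb; rewrite ler0_norm// /d intrB intrM natrM -[j%:~R]/(j%:R); lra.
Qed.

(** * Prefix weights and cylinder neighbourhoods *)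

Definition prefix_weight (y : cantor_space) (n : nat) : nat :=
  weight (mkseq y n).

Lemma prefix_weight0 y : prefix_weight y 0 = 0%N. Proof. by []. Qed.

Lemma prefix_weightD y i n :
  prefix_weight y (i + n) =
  (prefix_weight y i + weight (mkseq (fun k => y (i + k)%N) n))%N.
Proof.
rewrite /prefix_weight /weight /mkseq iotaD map_cat count_cat add0n.
by rewrite -[in iota i n](addn0 i) iotaDl -map_comp.
Qed.

Lemma prefix_weightS y n : prefix_weight y n.+1 = (prefix_weight y n + y n)%N.
Proof. by rewrite -addn1 prefix_weightD /weight /= addn0 eqb_id addn0. Qed.

Lemma prefix_weight_shift y n :
  prefix_weight y n.+1 = (prefix_weight y 1 + prefix_weight (Defs.shift y) n)%N.
Proof. by rewrite -add1n prefix_weightD. Qed.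

Lemma eq_prefix_weight (y z : cantor_space) n :
  (forall i, (i < n)%N -> y i = z i) -> prefix_weight y n = prefix_weight z n.
Proof.
by move=> yz; congr (count_mem _ _); apply/eq_in_map => i; rewrite mem_iota => /yz.
Qed.

Lemma nbhs_prefix (y : cantor_space) n :
  nbhs y [set z : cantor_space | forall i, (i < n)%N -> z i = y i].
Proof.
elim: n => [|n IHn]; first by near=> z.
have yn : nbhs y [set z : cantor_space | z n = y n].
  have := @proj_continuous nat (fun=> bool) n y.
  by move=> /(_ [set y n]); apply; exact/principal_filterP.
apply: filterS (filterI IHn yn) => z [zi zn] i.
by rewrite ltnS leq_eqVlt => /predU1P[->|/zi].
Unshelve. all: by end_near. Qed.

Lemma closed_prefix (X : set cantor_space) :
  (forall y, (forall n, exists z, X z /\ forall i, (i < n)%N -> z i = y i) ->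
     X y) -> closed X.
Proof.
move=> Xp y clXy; apply: Xp => n.
by have [z [Xz zy]] := clXy _ (nbhs_prefix y n); exists z.
Qed.

(** * Words with discrepancy confined to a band *)

Section banded_words.
Variables (R : realType) (alpha : R).

Definition discrepancy (y : cantor_space) (n : nat) : R :=
  (prefix_weight y n)%:R - n%:R * alpha.

(* Up to endpoints, [band t] meets every coset of Z exactly once, so a word
   whose discrepancy stays in a translate of it codes a rotation by alpha. *)
Definition band (t : R) : set R :=
  [set v | [\/ -1 <= v <= -1 + t / 2, -1 + t <= v <= 0 | t / 2 <= v <= t]].

(** Since [rho] may depend on [n], membership is a condition on each finite prefix separately, and
    closedness needs no limit of offsets. *)
Definition banded (t : R) : set cantor_space :=
  [set y | forall n, exists rho, forall k, (k <= n)%N ->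
     band t (discrepancy y k - rho)].

(** The bounds on [t] send both outer intervals into the middle one, the left by letter 1 and the
    right by letter 0. From the middle, letter 0 is used while it stays above [-1 + t]; otherwise
    letter 1 lands below [t] and misses the band only in the gap between 0 and [t / 2], and then
    letter 0 lands in the left interval. *)
Lemma band_step t v : 0 < t -> t <= alpha -> t <= 1 - alpha -> band t v ->
  exists b : bool, band t (v - alpha + b%:R).
Proof.
move=> t0 ta ta1; rewrite /band/= => -[] h.
- by exists true; apply: Or32 => /=; apply/andP; split; lra.
- have [h1|h1] := lerP (-1 + t) (v - alpha).
    by exists false; apply: Or32 => /=; apply/andP; split; lra.
  have [h2|h2] := lerP (v - alpha + 1) 0.
    by exists true; apply: Or32 => /=; apply/andP; split; lra.
  have [h3|h3] := lerP (t / 2) (v - alpha + 1).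
    by exists true; apply: Or33 => /=; apply/andP; split; lra.
  by exists false; apply: Or31 => /=; apply/andP; split; lra.
- by exists false; apply: Or32 => /=; apply/andP; split; lra.
Qed.

Lemma banded_nonempty t : 0 < t -> t <= alpha -> t <= 1 - alpha ->
  banded t !=set0.
Proof.
move=> t0 ta ta1.
have : forall v, {b : bool | band t v -> band t (v - alpha + b%:R)}.
  move=> v; apply: cid; have [vb|nvb] := pselect (band t v).
    by have [b vb'] := band_step t0 ta ta1 vb; exists b.
  by exists true.
move=> /all_sig[b bP].
(* The orbit of 0 under the chosen letters is the discrepancy of the word they spell, so [rho = 0]
   works for all prefixes. *)
pose v := fix v (n : nat) : R :=
  if n is m.+1 then v m - alpha + (b (v m))%:R else 0.
pose y : cantor_space := fun n => b (v n).
have vb n : band t (v n).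
  elim: n => [|n IHn /=]; last exact: bP.
  by apply: Or32; rewrite /=; apply/andP; split; lra.
have vE n : discrepancy y n = v n.
  elim: n => [|n IHn]; first by rewrite /discrepancy prefix_weight0 mul0r subrr.
  move: IHn; rewrite /discrepancy prefix_weightS natrD -(natr1 n) => IHn.
  rewrite -[v n.+1]/(v n - alpha + (y n)%:R); lra.
by exists y => n; exists 0 => k _; rewrite subr0 vE.
Qed.

Lemma banded_subshift t : 0 < t -> t <= alpha -> t <= 1 - alpha ->
  subshift (banded t).
Proof.
move=> t0 ta ta1; split; first exact: banded_nonempty.
- apply: closed_prefix => y yP n; have [z [zX zy]] := yP n.
  have [rho rhoP] := zX n; exists rho => k kn.
  rewrite /discrepancy (@eq_prefix_weight y z) -?/(discrepancy z k); first exact: rhoP.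
  by move=> i ik; rewrite zy// (leq_trans ik).
- move=> _ [y yX <-] n; have [rho rhoP] := yX n.+1.
  (* Dropping the first letter translates the discrepancy by a constant, which the offset
     absorbs. *)
  exists (rho - discrepancy y 1) => k kn.
  suff -> : discrepancy (Defs.shift y) k - (rho - discrepancy y 1) =
            discrepancy y k.+1 - rho by exact: rhoP.
  rewrite /discrepancy (prefix_weight_shift y k) natrD -(natr1 k); ring.
Qed.

Lemma banded_osc t y i j : 0 < t < 1 -> banded t y ->
  `|discrepancy y i - discrepancy y j| <= 1 + t.
Proof.
move=> t01 /(_ (maxn i j))[rho rhoP].
have bnd v : band t v -> -1 <= v <= t.
  by rewrite /band/= => -[] h; apply/andP; split; lra.
have := bnd _ (rhoP i (leq_maxl _ _)); have := bnd _ (rhoP j (leq_maxr _ _)).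
by rewrite ler_norml => h1 h2; apply/andP; split; lra.
Qed.

(* By density of the multiples of alpha modulo 1, the discrepancy comes close
   to both ends -1 and t of the band. *)
Lemma banded_osc_ge t eps y : irrational alpha -> 0 < t < 1 -> 0 < eps ->
  banded t y -> exists i j, 1 + t - eps < discrepancy y i - discrepancy y j.
Proof.
move=> irr t01 e0 yX.
(* With [e <= t / 2], the integer translates of the intervals from 0 to [e] and from [t - e] to [t]
   meet the band only next to -1 and next to [t] respectively: the other translates fall in its gaps
   or outside it. *)
pose e := Num.min (eps / 2) (t / 2).
have ee : e <= eps / 2 by rewrite ge_min lexx.
have et : e <= t / 2 by rewrite ge_min lexx orbT.
have {}e0 : 0 < e by rewrite lt_min; apply/andP; split; lra.
have [N NP] := multiples_dense_mod1 irr e0.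
have [rho rhoP] := yX N.
have hit a : exists k (z : int), band t (discrepancy y k - rho) /\
    a < discrepancy y k - rho - z%:~R < a + e.
  (* The discrepancy contains [- k alpha], so the target interval is reflected. *)
  have [k [m [kN km]]] := NP (- rho - a - e).
  exists k, ((prefix_weight y k)%:Z - m); split; first exact: rhoP.
  rewrite /discrepancy intrB -[(prefix_weight y k)%:~R]/((prefix_weight y k)%:R).
  by apply/andP; split; lra.
have zcases (z : int) : [\/ z%:~R <= -2 :> R, z = -1, z = 0 | 1 <= z%:~R :> R].
  have [h|h] := lerP z (-2); first by apply: Or41; rewrite -[-2]/((-2)%:~R) ler_int.
  have [h'|h'] := lerP 1 z; first by apply: Or44; rewrite -[1]/(1%:~R) ler_int.
  have : z = -1 \/ z = 0 by lia.
  by case=> ->; [apply: Or42|apply: Or43].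
have [j [z [jb jz]]] := hit 0.
have [i [z' [ib iz]]] := hit (t - e).
exists i, j.
have jlt : discrepancy y j - rho < -1 + e.
  move: jb jz; rewrite /band/=.
  by case: (zcases z) => [h|->|->|h] + jz; case=> h'; lra.
have ilt : t - e < discrepancy y i - rho.
  move: ib iz; rewrite /band/=.
  by case: (zcases z') => [h|->|->|h] + iz; case=> h'; lra.
lra.
Qed.

Lemma banded_disjoint s t y : irrational alpha -> 0 < s < 1 -> 0 < t < 1 ->
  banded s y -> banded t y -> s = t.
Proof.
wlog st : s t / s < t.
  move=> H irr s01 t01 ys yt; have [st|st|//] := ltgtP s t; first exact: H.
  exact/esym/H.
move=> irr s01 t01 ys yt.
have e0 : 0 < t - s by lra.
(* Taking [eps = t - s] yields an oscillation above [1 + s]. *)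
have [i [j]] := banded_osc_ge irr t01 e0 yt.
have := banded_osc i j s01 ys; rewrite ler_norml; lra.
Qed.

End banded_words.

(** * Weights of windows *)

Definition window_weight (y : cantor_space) (i n : nat) : nat :=
  weight (mkseq (fun k => y (i + k)%N) n).

Lemma window_weightD y i m n : window_weight y i (m + n) =
  (window_weight y i m + window_weight y (i + m) n)%N.
Proof.
have windowE j k :
    (prefix_weight y j + window_weight y j k)%N = prefix_weight y (j + k).
  by rewrite prefix_weightD.
by apply: (@addnI (prefix_weight y i)); rewrite addnA !windowE addnA.
Qed.

Lemma window_weight_size y i n : (window_weight y i n <= n)%N.
Proof.
by rewrite -[leqRHS](size_mkseq (fun k => y (i + k)%N)); exact: count_size.
Qed.

Lemma window_weight_step y i n :
  (window_weight y i.+1 n <= (window_weight y i n).+1)%N /\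
  (window_weight y i n <= (window_weight y i.+1 n).+1)%N.
Proof.
have h1 := window_weight_size y i 1; have h2 := window_weight_size y (i + n) 1.
have := window_weightD y i 1 n; rewrite addnC window_weightD !addn1; lia.
Qed.

Lemma window_weight_muln_le y n m k :
  (forall i, window_weight y i n <= m)%N ->
  forall i, (window_weight y i (k * n) <= k * m)%N.
Proof.
move=> ym; elim: k => [|k IHk] i //.
by rewrite !mulSn window_weightD leq_add.
Qed.

Lemma window_weight_muln_ge y n m k :
  (forall i, m <= window_weight y i n)%N ->
  forall i, (k * m <= window_weight y i (k * n))%N.
Proof.
move=> ym; elim: k => [|k IHk] i //.
by rewrite !mulSn window_weightD leq_add.
Qed.

(** Steps of size at most 1 cannot skip [m]. As [i] may precede or follow [j], the induction on the
    distance handles upward and downward crossings together. *)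
Lemma discrete_ivt (g : nat -> nat) (m i j : nat) :
  (forall k, (g k.+1 <= (g k).+1)%N /\ (g k <= (g k.+1).+1)%N) ->
  (g i <= m <= g j)%N -> exists k, g k = m.
Proof.
move=> gstep gij.
have H d : forall k, (g k <= m <= g (k + d))%N \/ (g (k + d) <= m <= g k)%N ->
    exists k, g k = m.
  elim: d => [|d IHd] k; first by rewrite addn0 => -[] h; exists k; lia.
  have [|gkm] := eqVneq (g k) m; first by exists k.
  by rewrite -addSnnS => -[] h; apply: (IHd k.+1); have := gstep k; [left|right]; lia.
have [ij|/ltnW ji] := leqP i j.
- by apply: (H (j - i)%N i); rewrite subnKC//; left.
- by apply: (H (i - j)%N j); rewrite subnKC//; right.
Qed.

Lemma language_nP (y : cantor_space) n u :
  language_n y n u -> exists i, u = mkseq (fun k => y (i + k)%N) n.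
Proof. by case=> -[i [n' ->]]; rewrite size_mkseq => <-; exists i. Qed.

Lemma max_weight_le y n m :
  (forall i, window_weight y i n <= m)%N -> (max_weight y n <= m)%N.
Proof.
by move=> ym; apply/bigmax_leqP => v /asboolP/language_nP[i ->]; exact: ym.
Qed.

(** The bound [m <= n] covers the default value [n] of the minimum. *)
Lemma min_weight_ge y n m : (m <= n)%N ->
  (forall i, m <= window_weight y i n)%N -> (m <= min_weight y n)%N.
Proof.
move=> mn ym; rewrite /min_weight; elim/big_ind: _ => //.
- by move=> a b ma mb; rewrite leq_min ma.
- by move=> v /asboolP/language_nP[i ->]; exact: ym.
Qed.

Lemma min_weight_size y n : (min_weight y n <= n)%N.
Proof.
rewrite /min_weight; elim/big_ind: _ => //.
- by move=> a b an bn; rewrite geq_min an.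
- by move=> v /asboolP/language_nP[i ->]; exact: window_weight_size.
Qed.

(** * Heavy and light windows from the frequency *)

Section frequency.
Variables (R : realType) (x : cantor_space) (alpha : R).
Hypothesis x_freq : uniform_frequency x alpha.

(** Along the multiples of [n] the ratio is at most [m / n], and this bound passes to the limit. *)
Lemma ratio_limit_le (u : nat -> nat) (n m : nat) : (0 < n)%N ->
  ((u k)%:R / k%:R : R) @[k --> \oo] --> alpha ->
  (forall k, u (k * n) <= k * m)%N -> n%:R * alpha <= m%:R.
Proof.
move=> n0 /cvgrPdist_lt ua um; rewrite leNgt; apply/negP => mn.
have n0R : 0 < n%:R :> R by rewrite ltr0n.
have e0 : 0 < alpha - m%:R / n%:R.
  by rewrite subr_gt0 ltr_pdivrMr// mulrC.
have [N _ /(_ (N.+1 * n)%N)] := ua _ e0.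
have /[swap]/[apply] : (N <= N.+1 * n)%N by nia.
suff : (u (N.+1 * n)%N)%:R / (N.+1 * n)%:R <= m%:R / n%:R :> R.
  by move=> h; rewrite /= ltr_norml => /andP[_]; rewrite ltrD2l ltrN2 ltNge h.
rewrite ler_pdivrMr ?ltr0n ?muln_gt0// natrM mulrCA divfK ?gt_eqF//.
by rewrite -natrM ler_nat um.
Qed.

Lemma ratio_limit_ge (u : nat -> nat) (n m : nat) : (0 < n)%N ->
  ((u k)%:R / k%:R : R) @[k --> \oo] --> alpha ->
  (forall k, k * m <= u (k * n))%N -> m%:R <= n%:R * alpha.
Proof.
move=> n0 /cvgrPdist_lt ua um; rewrite leNgt; apply/negP => mn.
have n0R : 0 < n%:R :> R by rewrite ltr0n.
have e0 : 0 < m%:R / n%:R - alpha.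
  by rewrite subr_gt0 ltr_pdivlMr// mulrC.
have [N _ /(_ (N.+1 * n)%N)] := ua _ e0.
have /[swap]/[apply] : (N <= N.+1 * n)%N by nia.
suff : m%:R / n%:R <= (u (N.+1 * n)%N)%:R / (N.+1 * n)%:R :> R.
  by move=> h; rewrite /= ltr_norml opprB => /andP[+ _]; rewrite ltrD2l ltrN2 ltNge h.
rewrite ler_pdivlMr ?ltr0n ?muln_gt0// natrM mulrCA divfK ?gt_eqF//.
by rewrite -natrM ler_nat um.
Qed.

Lemma frequency_itv : 0 <= alpha <= 1.
Proof.
case: x_freq => _ hm; apply/andP; split.
- have := @ratio_limit_ge _ 1 0 isT hm; rewrite mul1r; apply=> k.
  by rewrite muln0.
- have := @ratio_limit_le _ 1 1 isT hm; rewrite mul1r; apply=> k.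
  by rewrite !muln1; exact: min_weight_size.
Qed.

(** Otherwise all windows of length [n] weigh at most [c - 1], the largest integer below [n alpha];
    concatenating them would force the frequency down to [(c - 1) / n < alpha]. *)
Lemma heavy_window n : exists i, n%:R * alpha <= (window_weight x i n)%:R.
Proof.
have [->|n0] := posnP n; first by exists 0%N; rewrite mul0r.
apply: contrapT => H.
have {}H i : (window_weight x i n)%:R < n%:R * alpha.
  by rewrite ltNge; apply/negP => h; apply: H; exists i.
pose c := Num.ceil (n%:R * alpha).
have Hc i : (window_weight x i n)%:Z < c by rewrite /c ceil_gt_int; exact: H.
have mE : `|c - 1|%N%:Z = c - 1.
  by apply: gez0_abs; have := Hc 0%N; lia.
have mlt : `|c - 1|%N%:R < n%:R * alpha.
  rewrite -[ltLHS]/((`|c - 1|%N%:Z)%:~R) mE.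
  by case/andP: (ceil_itv (n%:R * alpha)).
suff : n%:R * alpha <= `|c - 1|%N%:R by rewrite leNgt mlt.
apply: (ratio_limit_le n0 x_freq.1) => k; apply: max_weight_le.
by apply: window_weight_muln_le => i; have := Hc i; lia.
Qed.

Lemma light_window n : exists i, (window_weight x i n)%:R <= n%:R * alpha.
Proof.
have [->|n0] := posnP n; first by exists 0%N; rewrite mul0r.
apply: contrapT => H.
have {}H i : n%:R * alpha < (window_weight x i n)%:R.
  by rewrite ltNge; apply/negP => h; apply: H; exists i.
have na0 : 0 <= n%:R * alpha.
  by rewrite mulr_ge0//; case/andP: frequency_itv.
pose m := (Num.truncn (n%:R * alpha)).+1.
have Hm i : (m <= window_weight x i n)%N by rewrite truncn_lt_nat.
suff : m%:R <= n%:R * alpha by rewrite leNgt truncnS_gt.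
apply: (ratio_limit_ge n0 x_freq.2) => k; apply: min_weight_ge.
  by rewrite leq_mul2l (leq_trans (Hm 0%N)) ?window_weight_size ?orbT.
exact: window_weight_muln_ge.
Qed.

End frequency.

(** * Existence of minimal subshifts *)

Lemma chain_bigcap_nonempty (X : topologicalType) (F : set (set X)) :
  compact [set: X] -> F !=set0 -> total_on F subset ->
  (forall A, F A -> closed A /\ A !=set0) -> \bigcap_(A in F) A !=set0.
Proof.
move=> cptX F0 Ftot FP.
(* A chain of non-empty sets is a filter base; a cluster point, given by compactness, lies in every
   closed member. *)
have fF : ProperFilter (filter_from F id).
  apply: filter_from_proper; last by move=> A /FP[].
  apply: filter_from_filter => // A B FA FB.
  by have [AB|BA] := Ftot _ _ FA FB; [exists A|exists B] => // x Hx; split=> //;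
    [exact: AB|exact: BA].
have [|p [_ clp]] := cptX _ fF; first exact: filterT.
exists p => A FA; have [clA _] := FP _ FA.
apply: clA => B pB; apply: clp => //; by exists A.
Qed.

Lemma subshift_bigcap (F : set (set cantor_space)) :
  F !=set0 -> total_on F subset -> F `<=` subshift ->
  subshift (\bigcap_(A in F) A).
Proof.
move=> F0 Ftot FP; split.
- apply: chain_bigcap_nonempty => //; first exact: cantor_space_compact.
  by move=> A /FP[].
- by apply: closed_bigI => A /FP[].
- move=> _ [y yF <-] A FA; have [_ _ shA] := FP _ FA.
  by apply: shA; exists y => //; exact: yF.
Qed.

(** Zorn's lemma for unions is applied to the part [A] removed from [X]: a maximal removable part
    leaves a minimal subshift, and unions of removed parts become intersections of subshifts. *)
Lemma minimal_subshift_exists (X : set cantor_space) : subshift X ->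
  exists2 M, minimal_subshift M & M `<=` X.
Proof.
move=> Xsub.
pose P (A : set cantor_space) := subshift (X `\` A).
have [F FP Ftot|A [PA Amax]] := @Zorn_bigcup _ P.
  have [->|/set0P[A0 FA0]] := eqVneq F set0.
    by rewrite /P bigcup_set0 setD0.
  rewrite /P setDE setC_bigcup -bigcapIr; last by exists A0.
  rewrite -(bigcap_image F (fun A => X `&` ~` A) id).
  apply: subshift_bigcap; first by exists (X `&` ~` A0), A0.
  - move=> _ _ [A FA <-] [B FB <-].
    have [AB|BA] := Ftot _ _ FA FB; [right|left]; apply: setIS; exact: subsetC.
  - by move=> _ [A FA <-]; rewrite -setDE; exact: FP.
exists (X `\` A); last by move=> y [].
split=> // Y Ysub [YX nXY].
have YE : X `\` ~` Y = Y by rewrite setDE setCK setIidr// => y /YX[].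
apply: (Amax (~` Y)); last by rewrite /P YE.
split; first by move=> a Aa /YX[_ /(_ Aa)].
by move=> YA; apply: nXY => y [Xy nAy]; apply: contrapT => /YA.
Qed.

(** * Banded words in the abelian closure *)

Lemma abelian_closure_windows (x y : cantor_space) :
  (forall i n, exists j, window_weight x j n = window_weight y i n) ->
  abelian_closure x y.
Proof.
move=> xy u [i [n ->]]; have [j xj] := xy i n.
exists (mkseq (fun k => x (j + k)%N) n); split; first by exists j, n.
move=> [|]; first exact/esym.
apply/(@addnI (window_weight y i n)); rewrite -[in RHS]xj.
rewrite /window_weight /weight.
have countE (v : seq bool) : (count_mem true v + count_mem false v = size v)%N.
  rewrite -(count_predC (pred1 true) v); congr addn.
  by apply: eq_count => -[].
by rewrite !countE !size_mkseq.
Qed.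

(** Only finitely many [n] occur, and for each [n alpha] is not an integer. If [r] is its fractional
    part, the integers at distance at least 1 from it are at distance at least
    [1 + min(r, 1 - r)]. *)
Lemma weight_gap (R : realType) (alpha : R) (n0 : nat) : irrational alpha ->
  exists2 d : R, 0 < d & forall n m : nat, (0 < n < n0)%N ->
    `|m%:R - n%:R * alpha| <= 1 + d -> `|m%:R - n%:R * alpha| < 1.
Proof.
move=> irr; elim: n0 => [|n0 [d d0 IHd]]; first by exists 1 => // n m; lia.
have [->|n00] := posnP n0; first by exists 1 => // n m; lia.
pose r := n0%:R * alpha - (Num.floor (n0%:R * alpha))%:~R.
have r1 : r < 1.
  by have := floor_itv (n0%:R * alpha); rewrite intrD /r; lra.
have r0 : 0 < r.
  rewrite lt_neqAle eq_sym subr_eq0 irrational_mulrn_neq//=.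
  by rewrite subr_ge0 floor_le.
pose d' := Num.min d (Num.min (r / 2) ((1 - r) / 2)).
have dd : d' <= d by rewrite ge_min lexx.
have dr : d' <= r / 2 by rewrite !ge_min lexx orbT.
have dr1 : d' <= (1 - r) / 2 by rewrite !ge_min lexx !orbT.
exists d'; first by rewrite !lt_min d0; apply/andP; split; lra.
move=> n m /andP[n_gt0]; rewrite ltnS leq_eqVlt => /predU1P[->|nn0] h; last first.
  by apply: IHd; [rewrite n_gt0|lra].
move: h.
have -> : m%:R - n0%:R * alpha = (m%:Z - Num.floor (n0%:R * alpha))%:~R - r.
  by rewrite intrB -[m%:~R]/(m%:R) /r; lra.
move: (m%:Z - _) => z h.
have [z2|z1] := lerP 2 z.
  have : 2 <= z%:~R :> R by rewrite -[2]/(2%:~R) ler_int.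
  by move: h; rewrite ler_norml; lra.
have [zN1|z0] := lerP z (-1).
  have : z%:~R <= -1 :> R by rewrite -[-1]/((-1)%:~R) ler_int.
  by move: h; rewrite ler_norml; lra.
have : z = 0 \/ z = 1 by lia.
by case=> ->; rewrite ltr_norml; apply/andP; split; lra.
Qed.

Section banded_in_closure.
Variables (R : realType) (x : cantor_space) (alpha : R).
Hypothesis x_freq : uniform_frequency x alpha.
Variable n0 : nat.
Hypothesis x_weights : forall n : nat, (n0 <= n)%N ->
  (exists u, language_n x n u /\
     (weight u)%:Z = Num.ceil (n%:R * alpha) + 1) /\
  (exists v, language_n x n v /\
     (weight v)%:Z = Num.floor (n%:R * alpha) - 1).

(** Sliding a window along [x] changes its weight by at most 1, so it is enough to find one window
    of weight at most [m] and one of weight at least [m]. They come from the frequency when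
    [n < n0], and from [x_weights] together with [t < 1] otherwise. *)
Lemma window_weight_exists (t : R) (n m : nat) :
  ((0 < n < n0)%N -> `|m%:R - n%:R * alpha| <= 1 + t ->
     `|m%:R - n%:R * alpha| < 1) ->
  0 < t < 1 -> (m <= n)%N -> `|m%:R - n%:R * alpha| <= 1 + t ->
  exists j, window_weight x j n = m.
Proof.
move=> gap t01 mn mt.
suff [i [j [im mj]]] : exists i j, (window_weight x i n)%:R < m%:R + 1 :> R /\
    m%:R - 1 < (window_weight x j n)%:R :> R.
  apply: (@discrete_ivt (window_weight x ^~ n) m i j).
    by move=> k; exact: window_weight_step.
  move: im mj; by rewrite ltrBlDr !natr1 !ltr_nat !ltnS => -> ->.
have [nn0|n0n] := ltnP n n0.
- have [j hj] := heavy_window x_freq n; have [i li] := light_window x_freq n.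
  exists i, j.
  have [n_0|n_gt0] := posnP n.
    move: mn hj li; rewrite n_0 leqn0 mul0r => /eqP ->; lra.
  have := gap; rewrite n_gt0 nn0 => /(_ isT mt); rewrite ltr_norml; lra.
- have [[_ [/language_nP[j ->] wj]] [_ [/language_nP[i ->] wi]]] := x_weights n0n.
  exists i, j; rewrite -/(window_weight x i n) -/(window_weight x j n) in wi wj *.
  have {}wj : (window_weight x j n)%:R = (Num.ceil (n%:R * alpha))%:~R + 1 :> R.
    by rewrite -[LHS]/((window_weight x j n)%:Z%:~R) wj intrD.
  have {}wi : (window_weight x i n)%:R = (Num.floor (n%:R * alpha))%:~R - 1 :> R.
    by rewrite -[LHS]/((window_weight x i n)%:Z%:~R) wi intrB.
  move: mt (floor_le (n%:R * alpha)) (ceil_ge (n%:R * alpha)).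
  rewrite ler_norml wi wj; lra.
Qed.

(** A window weight minus [n alpha] is a difference of two discrepancies, hence at most [1 + t] in
    absolute value. *)
Lemma banded_sub_abelian_closure (t : R) : 0 < t < 1 ->
  (forall n m : nat, (0 < n < n0)%N -> `|m%:R - n%:R * alpha| <= 1 + t ->
     `|m%:R - n%:R * alpha| < 1) ->
  banded alpha t `<=` abelian_closure x.
Proof.
move=> t01 gap y yt; apply: abelian_closure_windows => i n.
apply: (window_weight_exists (gap n _) t01); first exact: window_weight_size.
have := banded_osc (i + n)%N i t01 yt.
suff -> : discrepancy alpha y (i + n)%N - discrepancy alpha y i =
    (window_weight y i n)%:R - n%:R * alpha by [].
rewrite /discrepancy prefix_weightD -/(window_weight y i n) !natrD; ring.
Qed.

End banded_in_closure.

(** * Uncountably many minimal subshifts *)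

Lemma uncountable_itv (R : realType) (d : R) : 0 < d -> ~ countable `]0, d[%classic.
Proof.
move=> d0 /countable_lebesgue_measure0; rewrite lebesgue_measure_itv /= lte_fin d0.
by rewrite oppr0 adde0 => -[] /eqP; rewrite gt_eqF.
Qed.

Theorem proposition8p1 (R : realType) (x : cantor_space) (alpha : R)
    (x_rec : uniformly_recurrent x)
    (x_freq : uniform_frequency x alpha)
    (alpha_irr : irrational alpha)
    (x_weights : exists n0 : nat, forall n : nat, (n0 <= n)%N ->
       (exists u, language_n x n u /\
          (weight u)%:Z = Num.ceil (n%:R * alpha) + 1) /\
       (exists v, language_n x n v /\
          (weight v)%:Z = Num.floor (n%:R * alpha) - 1)) :
  ~ countable [set X : set cantor_space |
      minimal_subshift X /\ X `<=` abelian_closure x].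
Proof.
have [n0 xw] := x_weights.
have /andP[a0 a1] := frequency_itv x_freq.
have an0 : alpha != 0.
  by have := irrational_mulrn_neq 0 alpha_irr (ltn0Sn 0); rewrite mul1r.
have an1 : alpha != 1.
  by have := irrational_mulrn_neq 1 alpha_irr (ltn0Sn 0); rewrite mul1r.
have {an0}a0 : 0 < alpha by rewrite lt_neqAle eq_sym an0.
have {an1}a1 : 0 < 1 - alpha by rewrite subr_gt0 lt_neqAle an1.
have [d d0 gap] := weight_gap n0 alpha_irr.
pose e := Num.min d (Num.min alpha (1 - alpha)).
have e0 : 0 < e by rewrite !lt_min d0 a0.
have good t : 0 < t < e -> [/\ 0 < t < 1, t <= alpha, t <= 1 - alpha & t <= d].
  by rewrite !lt_min => h; split; lra.
(* One minimal subshift is chosen for each admissible [t]; [setT] is a dummy value elsewhere. *)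
have /choice[M MP] : forall t, exists M, 0 < t < e ->
    minimal_subshift M /\ M `<=` banded alpha t.
  move=> t; have [te|nte] := boolP (0 < t < e); last by exists setT.
  have [/andP[t0 _] ta ta1 _] := good t te.
  have [M Mmin Mt] := minimal_subshift_exists (banded_subshift t0 ta ta1).
  by exists M.
move=> /countable_injP[f finj]; apply: (uncountable_itv e0).
have MA t : 0 < t < e -> minimal_subshift (M t) /\ M t `<=` abelian_closure x.
  move=> te; have [Mmin Mt] := MP t te; have [t01 _ _ td] := good t te.
  split=> //; apply: subset_trans Mt _.
  apply: (banded_sub_abelian_closure x_freq xw t01) => n m nn0 h.
  by apply: gap => //; apply: le_trans h _; rewrite lerD2l.
(* It remains to see that [M] is injective: a point of [M s = M t] lies in both [banded] sets, which
   forces [s = t]. *)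
apply/countable_injP; exists (f \o M) => s t.
rewrite !inE /= !in_itv /= => se te fst.
have Mst : M s = M t by apply: finj => //; apply/mem_set; exact: MA.
have [[[[y ys] _ _] _] sub_s] := MP s se; have [_ sub_t] := MP t te.
have [s01 _ _ _] := good s se; have [t01 _ _ _] := good t te.
apply: (banded_disjoint alpha_irr s01 t01 (sub_s _ ys)).
by apply: sub_t; rewrite -Mst.
Qed.
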